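(* Let $p$ and $q$ be terms in the language $\langle \vee,\wedge,{}^{*},0,1\rangle$ of QB-algebras. Then the identity $p\approx q$ holds in every QB-algebra if and only if $p\approx q$ holds in the algebra $\mathbf{4}$.
   Context: A quasi-lattice is an algebra $\langle L;\vee,\wedge\rangle$ such that for all $x,y,z$: $\vee,\wedge$ are commutative and associative; $x\vee(x\wedge y)=x\vee x$ and $x\wedge(x\vee y)=x\wedge x$; $x\vee(y\vee y)=x\vee y$ and $x\wedge(y\wedge y)=x\wedge y$; $x\vee x=x\wedge x$. It is distributive if $x\vee(y\wedge z)=(x\vee y)\wedge(x\vee z)$ and $x\wedge(y\vee z)=(x\wedge y)\vee(x\wedge z)$. A quasi-Boolean algebra (QB-algebra) is an algebra $\langle Q;\vee,\wedge,{}^{*},0,1\rangle$ of type $\langle 2,2,1,0,0\rangle$ such that $\langle Q;\vee,\wedge\rangle$ is a distributive quasi-lattice and for all $x$: $x\vee 1=1$, $x\wedge 0=0$, $x\vee x^{*}=1$, $x\wedge x^{*}=0$, $(x\wedge x)^{*}=x^{*}\vee x^{*}$, $x^{**}=x$. The QB-algebra $\mathbf{4}$ has universe $\{0,a,b,1\}$ with: $x\vee y=0$ if $x,y\in\{0,a\}$ and $x\vee y=1$ otherwise; $x\wedge y=1$ if $x,y\in\{b,1\}$ and $x\wedge y=0$ otherwise; $0^{*}=1$, $a^{*}=b$, $b^{*}=a$, $1^{*}=0$. *)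

(* Defs.v *)
From mathcomp Require Import all_boot.

Set Implicit Arguments.
Unset Strict Implicit.
Unset Printing Implicit Defensive.

(* Only the signature: the equations are imposed by the predicates below. *)
Record algebra : Type := Algebra {
  carrier :> Type;
  join : carrier -> carrier -> carrier;
  meet : carrier -> carrier -> carrier;
  star : carrier -> carrier;
  bot : carrier;
  top : carrier
}.

Declare Scope qb_scope.
Delimit Scope qb_scope with QB.
Notation "x ∨ y" := (join x y) (at level 50, left associativity) : qb_scope.
Notation "x ∧ y" := (meet x y) (at level 40, left associativity) : qb_scope.
Notation "x ^*" := (star x) : qb_scope.
Local Open Scope qb_scope.

Record is_quasi_lattice (L : algebra) : Prop := {
  joinC : commutative (@join L);
  meetC : commutative (@meet L);
  joinA : associative (@join L);
  meetA : associative (@meet L);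
  join_meet_absorb : forall x y : L, x ∨ (x ∧ y) = x ∨ x;
  meet_join_absorb : forall x y : L, x ∧ (x ∨ y) = x ∧ x;
  join_joinxx : forall x y : L, x ∨ (y ∨ y) = x ∨ y;
  meet_meetxx : forall x y : L, x ∧ (y ∧ y) = x ∧ y;
  joinxx_meetxx : forall x : L, x ∨ x = x ∧ x
}.

Record is_distributive (L : algebra) : Prop := {
  join_meet_distr : forall x y z : L, x ∨ (y ∧ z) = (x ∨ y) ∧ (x ∨ z);
  meet_join_distr : forall x y z : L, x ∧ (y ∨ z) = (x ∧ y) ∨ (x ∧ z)
}.

Record is_qb_algebra (Q : algebra) : Prop := {
  qb_quasi_lattice : is_quasi_lattice Q;
  qb_distributive : is_distributive Q;
  qb_join_top : forall x : Q, x ∨ top Q = top Q;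
  qb_meet_bot : forall x : Q, x ∧ bot Q = bot Q;
  qb_join_star : forall x : Q, x ∨ x^* = top Q;
  qb_meet_star : forall x : Q, x ∧ x^* = bot Q;
  qb_star_meetxx : forall x : Q, (x ∧ x)^* = x^* ∨ x^*;
  qb_star_star : forall x : Q, x^*^* = x
}.

Inductive term : Type :=
  | Var of nat
  | Join of term & term
  | Meet of term & term
  | Star of term
  | Bot
  | Top.

Fixpoint eval (A : algebra) (v : nat -> A) (t : term) : A :=
  match t with
  | Var n => v n
  | Join s t => eval v s ∨ eval v t
  | Meet s t => eval v s ∧ eval v t
  | Star s => (eval v s)^*
  | Bot => bot A
  | Top => top A
  end.

Definition holds (A : algebra) (p q : term) : Prop :=
  forall v : nat -> A, eval v p = eval v q.

Inductive four_elt : Type := F0 | Fa | Fb | F1.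

Definition four_join (x y : four_elt) : four_elt :=
  match x, y with
  | (F0 | Fa), (F0 | Fa) => F0
  | _, _ => F1
  end.

Definition four_meet (x y : four_elt) : four_elt :=
  match x, y with
  | (Fb | F1), (Fb | F1) => F1
  | _, _ => F0
  end.

Definition four_star (x : four_elt) : four_elt :=
  match x with F0 => F1 | Fa => Fb | Fb => Fa | F1 => F0 end.

Definition four : algebra := Algebra four_join four_meet four_star F0 F1.

(* Main.v *)
From mathcomp Require Import all_boot.
Require Import Defs.

Set Implicit Arguments.
Unset Strict Implicit.
Unset Printing Implicit Defensive.

Local Open Scope qb_scope.

(** Every term either is a literal, that is a variable under some number of
stars, or takes only idempotent values in every QB-algebra. The elements a and
b of 4, which are not idempotent, tell distinct literals apart and tell a
literal from a non-literal. For two non-literals, {0,1} inside 4 is the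
two-element Boolean algebra, and a Shannon expansion, which replaces one
variable at a time by 0 or 1 below [e ∧ v n] and [e ∧ (v n)^*], transfers an
identity from {0,1} to any QB-algebra. *)

Section QBTheory.
Variables (Q : algebra) (HQ : is_qb_algebra Q).
Implicit Types (e x y z : Q) (t : term).

Let HL := qb_quasi_lattice HQ.
Let HD := qb_distributive HQ.

Lemma meet_top x : x ∧ top Q = x ∧ x.
Proof. by rewrite -(qb_join_star HQ x) (meet_join_absorb HL). Qed.

Lemma join_bot x : x ∨ bot Q = x ∨ x.
Proof. by rewrite -(qb_meet_star HQ x) (join_meet_absorb HL). Qed.

Lemma meet_idem x y : (x ∧ y) ∧ (x ∧ y) = x ∧ y.
Proof.
rewrite (meetA HL) (meetC HL (x ∧ y) x) (meetA HL) -(meetA HL) (meet_meetxx HL).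
by rewrite (meetC HL) (meet_meetxx HL) (meetC HL).
Qed.

Lemma join_idem x y : (x ∨ y) ∧ (x ∨ y) = x ∨ y.
Proof.
rewrite -(joinxx_meetxx HL).
rewrite (joinA HL) (joinC HL (x ∨ y) x) (joinA HL) -(joinA HL) (join_joinxx HL).
by rewrite (joinC HL) (join_joinxx HL) (joinC HL).
Qed.

Lemma star_idem x : x ∧ x = x -> x^* ∧ x^* = x^*.
Proof. by move=> xx; rewrite -(joinxx_meetxx HL) -(qb_star_meetxx HQ) xx. Qed.

Lemma bot_idem : bot Q ∧ bot Q = bot Q.
Proof. exact: qb_meet_bot. Qed.

Lemma top_idem : top Q ∧ top Q = top Q.
Proof. by rewrite -(joinxx_meetxx HL) (qb_join_top HQ). Qed.

Lemma star_bot : (bot Q)^* = top Q.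
Proof.
rewrite -(star_idem bot_idem) -(joinxx_meetxx HL) -join_bot (joinC HL).
exact: qb_join_star.
Qed.

Lemma star_top : (top Q)^* = bot Q.
Proof. by rewrite -star_bot (qb_star_star HQ). Qed.

(** The meet [e ∧ x^*] is idempotent, so it absorbs [top = y ∨ y^*]; its part under [y] is
    [e ∧ x ∧ x^*] up to order, hence [bot]. *)
Lemma meet_meet_star e x y :
  e ∧ x = e ∧ y -> e ∧ x^* = (e ∧ x^*) ∧ y^*.
Proof.
move=> exy.
rewrite -{1}(meet_idem e (x^*)) -meet_top -(qb_join_star HQ y).
rewrite (meet_join_distr HD) -(meetA HL) (meetC HL (x^*) y) (meetA HL) -exy.
rewrite -(meetA HL) (qb_meet_star HQ) (qb_meet_bot HQ) (joinC HL) join_bot.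
by rewrite (joinxx_meetxx HL) meet_idem.
Qed.

(* Uniqueness of complements below [e]; this makes De Morgan's laws
unnecessary. *)
Lemma meet_star_congr e x y : e ∧ x = e ∧ y -> e ∧ x^* = e ∧ y^*.
Proof.
move=> exy; rewrite (meet_meet_star exy) (meet_meet_star (esym exy)).
by rewrite -!(meetA HL) (meetC HL (x^*)).
Qed.

(** For fixed [e], having the same meet with [e] is a congruence; this is what allows values to be
    substituted below [e]. *)
Lemma meet_eval_congr e (v w : nat -> Q) t :
  (forall k, e ∧ v k = e ∧ w k) -> e ∧ eval v t = e ∧ eval w t.
Proof.
move=> evw; elim: t => [k|s IHs t IHt|s IHs t IHt|s IHs||] //=.
- by rewrite !(meet_join_distr HD) IHs IHt.
- rewrite !(meetA HL) IHs -!(meetA HL) (meetC HL (eval w s)) (meetA HL) IHt.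
  by rewrite -(meetA HL) (meetC HL (eval w t)).
- exact: meet_star_congr.
Qed.

(** One step of the Shannon expansion: [e ∧ y] is idempotent, so it is unchanged by a meet with
    [top = x ∨ x^*]. *)
Lemma meet_split e x y :
  e ∧ y = ((e ∧ x) ∧ y) ∨ ((e ∧ x^*) ∧ y).
Proof.
rewrite -{1}(meet_idem e y) -meet_top -(qb_join_star HQ x) (meet_join_distr HD).
by rewrite -!(meetA HL) !(meetC HL y).
Qed.

End QBTheory.

Definition two : algebra := @Algebra bool orb andb negb false true.

Definition of_two (A : algebra) (b : bool) : A := if b then top A else bot A.

Lemma eval_of_two (Q : algebra) (u : nat -> two) (t : term) :
  is_qb_algebra Q ->
  eval (fun k => of_two Q (u k)) t = of_two Q (eval u t).
Proof.
move=> HQ; have HL := qb_quasi_lattice HQ.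
elim: t => [k|s IHs t IHt|s IHs t IHt|s IHs||] //=.
- rewrite IHs IHt /of_two; case: (eval u s) => /=.
    by rewrite (joinC HL) (qb_join_top HQ).
  case: (eval u t); first exact: qb_join_top.
  by rewrite (joinxx_meetxx HL) (bot_idem HQ).
- rewrite IHs IHt /of_two; case: (eval u s) => /=; last first.
    by rewrite (meetC HL) (qb_meet_bot HQ).
  by case: (eval u t); [exact: top_idem | exact: qb_meet_bot].
- by rewrite IHs; case: (eval u s); rewrite /of_two /=
    ?(star_top HQ) ?(star_bot HQ).
Qed.

Definition upd (T : Type) (v : nat -> T) (n : nat) (x : T) (k : nat) : T :=
  if k == n then x else v k.

(** Induction on the number [n] of variables not yet fixed to constants. The element [e] stays
    general because it collects the literals chosen along the expansion. *)
Lemma two_meet_eq (Q : algebra) (p q : term) :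
  is_qb_algebra Q -> holds two p q ->
  forall (n : nat) (v : nat -> Q) (u : nat -> two),
  (forall k, n <= k -> v k = of_two Q (u k)) ->
  forall e : Q, e ∧ eval v p = e ∧ eval v q.
Proof.
move=> HQ Hpq; have HL := qb_quasi_lattice HQ.
elim=> [|n IHn] v u Hvu e.
  have evu t : e ∧ eval v t = e ∧ eval (fun k => of_two Q (u k)) t.
    by apply: meet_eval_congr => // k; rewrite Hvu.
  by rewrite !evu !eval_of_two // Hpq.
(* Below any [x] where [v n] agrees with a constant, variable [n] can be fixed to it, which leaves
   only the variables under [n]. *)
have step x b : x ∧ v n = x ∧ of_two Q b -> x ∧ eval v p = x ∧ eval v q.
  move=> xv.
  have xvk k : x ∧ v k = x ∧ upd v n (of_two Q b) k.
    by rewrite /upd; case: eqP => [->|].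
  rewrite !(meet_eval_congr HQ _ xvk); apply: (IHn _ (upd u n b)) => k le_nk.
  rewrite /upd; case: eqP => // /eqP neq_kn.
  by apply: Hvu; rewrite ltn_neqAle eq_sym neq_kn.
rewrite (meet_split HQ e (v n)) (meet_split HQ e (v n) (eval v q)); congr (_ ∨ _).
- apply: (step _ true); rewrite /= (meet_top HQ) (meet_idem HQ).
  by rewrite -(meetA HL) (meet_meetxx HL).
- apply: (step _ false).
  by rewrite -(meetA HL) (meetC HL _ (v n)) (qb_meet_star HQ) !(qb_meet_bot HQ).
Qed.

Fixpoint var_bound (t : term) : nat :=
  match t with
  | Var k => k.+1
  | Join s t | Meet s t => maxn (var_bound s) (var_bound t)
  | Star s => var_bound s
  | Bot | Top => 0
  end.

Lemma eq_eval_bound (A : algebra) (v w : nat -> A) (t : term) :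
  (forall k, k < var_bound t -> v k = w k) -> eval v t = eval w t.
Proof.
elim: t => [k|s IHs t IHt|s IHs t IHt|s IHs||] //= Hvw; first exact: Hvw.
- by rewrite IHs ?IHt // => k lt_k; apply: Hvw; rewrite leq_max lt_k ?orbT.
- by rewrite IHs ?IHt // => k lt_k; apply: Hvw; rewrite leq_max lt_k ?orbT.
- by rewrite IHs.
Qed.

(** The expansion is used with [e = top]. Since a meet with [top] yields [x ∧ x] rather than [x],
    only the squares are compared. *)
Lemma two_meetxx_eq (Q : algebra) (p q : term) :
  is_qb_algebra Q -> holds two p q ->
  forall v : nat -> Q, eval v p ∧ eval v p = eval v q ∧ eval v q.
Proof.
move=> HQ Hpq v; have HL := qb_quasi_lattice HQ.
pose n := maxn (var_bound p) (var_bound q).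
(* Variables from [n] on occur in neither term; sending them to [bot] makes all but finitely many
   values constants. *)
pose w k := if k < n then v k else bot Q.
have vw t : var_bound t <= n -> eval v t = eval w t.
  move=> le_tn; apply: eq_eval_bound => k lt_kt.
  by rewrite /w (leq_trans lt_kt le_tn).
rewrite -!(meet_top HQ) !(meetC HL _ (top Q)) !vw ?leq_maxl ?leq_maxr //.
apply: (two_meet_eq HQ Hpq (n := n) (u := fun=> false)) => k le_nk.
by rewrite /w ltnNge le_nk.
Qed.

(* [Some (n, b)] when the term is the variable [n] under a number of stars
whose parity is [b]. *)
Fixpoint literal (t : term) : option (nat * bool) :=
  match t with
  | Var n => Some (n, false)
  | Star s => omap (fun l => (l.1, ~~ l.2)) (literal s)
  | _ => None
  end.

Lemma eval_literal (Q : algebra) (v : nat -> Q) (t : term) n b :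
  is_qb_algebra Q -> literal t = Some (n, b) ->
  eval v t = if b then (v n)^* else v n.
Proof.
move=> HQ; elim: t n b => //= [k|s IHs] n b; first by case=> <- <-.
case: (literal s) IHs => //= -[m c] IHs [<- <-].
by rewrite (IHs _ _ erefl); case: c {IHs}; rewrite //= (qb_star_star HQ).
Qed.

(** Joins, meets and constants are idempotent, and [star] preserves idempotents. *)
Lemma eval_nonliteral (Q : algebra) (v : nat -> Q) (t : term) :
  is_qb_algebra Q -> literal t = None -> eval v t ∧ eval v t = eval v t.
Proof.
move=> HQ; elim: t => //= [s _ t _|s _ t _|s IHs||] Ht.
- exact: join_idem.
- exact: meet_idem.
- by apply: (star_idem HQ); apply: IHs; case: (literal s) Ht.
- exact: bot_idem.
- exact: top_idem.
Qed.

Lemma four_qb : is_qb_algebra four.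
Proof.
split; first split; try (split; by do 3!case); try by do 3!case.
all: by do ?case.
Qed.

(** The map [of_two four] is an injective homomorphism. *)
Lemma holds_four_two (p q : term) : holds four p q -> holds two p q.
Proof.
move=> Hpq u; have := Hpq (fun k => of_two four (u k)).
rewrite !(eval_of_two _ _ four_qb).
by case: (eval u p); case: (eval u q).
Qed.

Lemma holds_four_literal (p q : term) l :
  holds four p q -> literal p = Some l -> literal q = Some l.
Proof.
(* With variable [n] at [Fa] and the others at [F0], a literal in [n] takes the value [Fa] or [Fb]
   according to its parity, while every other term that is a literal or an idempotent takes a value
   in [{F0, F1}]. *)
case: l => n b Hpq litp; pose v (k : nat) : four := if k == n then Fa else F0.
have := Hpq v; rewrite (eval_literal _ four_qb litp) /v eqxx.
case litq: (literal q) => [[m c]|].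
  rewrite (eval_literal _ four_qb litq).
  by case: (eqVneq m n) => [->|_]; case: b litp; case: c litq.
by have /= := eval_nonliteral v four_qb litq; case: (eval _ q); case: b litp.
Qed.

Theorem theorem4p3 (p q : term) :
  (forall Q : algebra, is_qb_algebra Q -> holds Q p q) <-> holds four p q.
Proof.
split=> [H|Hpq Q HQ v]; first exact: H four_qb.
have Hqp : holds four q p by move=> w; rewrite Hpq.
case litp: (literal p) => [[n b]|].
  by rewrite !(eval_literal v HQ (n := n) (b := b)) // (holds_four_literal Hpq litp).
case litq: (literal q) => [l|].
  by rewrite (holds_four_literal Hqp litq) in litp.
(* Neither term is a literal, so both values equal their squares. *)
rewrite -(eval_nonliteral v HQ litp) -(eval_nonliteral v HQ litq).
exact: two_meetxx_eq (holds_four_two Hpq) v.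
Qed.
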